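(* Let $d\ge 2$ be an integer and let $\mathcal{X}$ be a finite nonempty set. Let $\theta_0$ denote the uniform distribution on $\mathcal{X}$. Then $$\mathbb{E}_\theta[M(T)]\le\mathbb{E}_{\theta_0}[M(T)]$$ for every probability distribution $\theta$ on $\mathcal{X}$, with equality if and only if $\theta=\theta_0$.
   Context: $\mathbb{E}_\theta$ means that $T=(T_1,\dots,T_d)$ consists of i.i.d. random variables with values in $\mathcal{X}$ and law $\theta$. For $t=(t_1,\dots,t_d)\in\mathcal{X}^d$, $M(t)$ is the number of distinct rearrangements of the tuple $t$, i.e. $M(t)=\dfrac{d!}{\prod_{\xi\in\mathcal{X}}r(t)_\xi!}$, where $r(t)_\xi:=\#\{i:t_i=\xi\}$. Thus $\mathbb{E}_\theta[M(T)]=\sum_{t\in\mathcal{X}^d}M(t)\prod_{i=1}^d\theta_{t_i}$. *)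

(* Defs.v *)
From mathcomp Require Import all_boot all_order all_algebra.
From mathcomp Require Import reals.

Set Implicit Arguments.
Unset Strict Implicit.
Unset Printing Implicit Defensive.

Import Order.TTheory GRing.Theory Num.Theory.
Local Open Scope ring_scope.

Definition is_distribution (R : realType) (T : finType) (p : {ffun T -> R}) :=
  (forall x, 0 <= p x) /\ \sum_(x : T) p x = 1.

Definition uniform (R : realType) (X : finType) : {ffun X -> R} :=
  [ffun=> #|X|%:R^-1].
Arguments uniform : clear implicits.

(* The joint law of d i.i.d. X-valued variables with law theta. *)
Definition iid_law (R : realType) (X : finType) (d : nat)
    (theta : {ffun X -> R}) : {ffun d.-tuple X -> R} :=
  [ffun t => \prod_(i < d) theta (tnth t i)].

Definition expectation (R : realType) (T : finType) (p : {ffun T -> R})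
    (f : T -> R) : R :=
  \sum_(t : T) f t * p t.

(* [permutations] lists every rearrangement exactly once, so this counts the
   distinct ones; [rearrangements_fact] is the multinomial formula. *)
Definition rearrangements (X : finType) (d : nat) (t : d.-tuple X) : nat :=
  size (permutations t).

Definition mean_rearrangements (R : realType) (X : finType) (d : nat)
    (theta : {ffun X -> R}) : R :=
  expectation (iid_law d theta) (fun t => (rearrangements t)%:R).

Lemma size_permutations_fact (X : finType) (s : seq X) :
  (size (permutations s) * \prod_(x : X) (count_mem x s)`! = (size s)`!)%N.
Proof.
move Dn: (size s) => n; elim: n s Dn => [|n IHn] s Dn.
  by rewrite (size0nil Dn) /= big1.
rewrite (perm_size (permutationsE _)) ?Dn // size_allpairs_dep sumnE.
rewrite big_map big_distrl /=.
have -> : (n.+1`! = \sum_(x <- undup s) count_mem x s * n`!)%N.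
  rewrite -big_distrl /= factS -Dn; congr (_ * _)%N.
  rewrite -{1}(perm_size (perm_count_undup s)) size_flatten sumnE !big_map.
  by apply: eq_bigr => x _; rewrite size_nseq.
apply: eq_big_seq => x; rewrite mem_undup => s_x.
have Dr : size (rem x s) = n by rewrite size_rem // Dn.
rewrite -(IHn _ Dr) mulnCA; congr (_ * _)%N.
have Ds : forall y, count_mem y s = ((x == y) + count_mem y (rem x s))%N.
  by move=> y; rewrite (permP (perm_to_rem s_x)).
rewrite (bigD1 x) //= [in RHS](bigD1 x) //= (Ds x) eqxx add1n factS -mulnA.
congr (_ * (_ * _))%N; apply: eq_bigr => y yx.
by rewrite Ds eq_sym (negPf yx).
Qed.

Lemma rearrangements_fact (X : finType) (d : nat) (t : d.-tuple X) :
  rearrangements t = (d`! %/ \prod_(x : X) #|[set i | tnth t i == x]|`!)%N.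
Proof.
have Dc x : #|[set i | tnth t i == x]| = count_mem x t.
  by rewrite cardsE -(map_tnth_enum t) count_map cardE size_filter enumT.
rewrite (eq_bigr (fun x => (count_mem x t)`!)) => [|x _]; last by rewrite Dc.
have := size_permutations_fact t; rewrite size_tuple => <-; rewrite mulnK //.
by rewrite prodn_gt0 // => x; rewrite fact_gt0.
Qed.

Lemma is_distribution_uniform (R : realType) (X : finType) :
  (0 < #|X|)%N -> is_distribution (uniform R X).
Proof.
move=> X0; split=> [x|]; first by rewrite ffunE invr_ge0 ler0n.
rewrite (eq_bigr (fun=> #|X|%:R^-1)) => [|x _]; last by rewrite ffunE.
by rewrite sumr_const -[RHS](@mulVf _ #|X|%:R) ?mulr_natr // pnatr_eq0 -lt0n.
Qed.

Lemma is_distribution_iid_law (R : realType) (X : finType) (d : nat)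
    (theta : {ffun X -> R}) :
  is_distribution theta -> is_distribution (iid_law d theta).
Proof.
move=> [theta_ge0 theta1]; split=> [t|].
  by rewrite ffunE prodr_ge0.
transitivity (\prod_(i < d) \sum_(x : X) theta x); last first.
  by rewrite theta1 big1.
rewrite bigA_distr_bigA /=.
rewrite (reindex (fun f : {ffun 'I_d -> X} => [tuple f i | i < d])) /=.
  by apply: eq_bigr => f _; rewrite ffunE; apply: eq_bigr => i _; rewrite tnth_mktuple.
exists (fun t : d.-tuple X => [ffun i => tnth t i]) => [f _|t _].
  by apply/ffunP=> i; rewrite ffunE tnth_mktuple.
by apply: eq_from_tnth => i; rewrite tnth_mktuple ffunE.
Qed.

Lemma mean_rearrangementsE (R : realType) (X : finType) (d : nat)
    (theta : {ffun X -> R}) :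
  mean_rearrangements d theta =
  \sum_(t : d.-tuple X)
     (rearrangements t)%:R * \prod_(i < d) theta (tnth t i).
Proof. by apply: eq_bigr => t _; rewrite ffunE. Qed.

(* Main.v *)
(** Let [n = #|X|] and let [G a] be the sum of a^r / r!^2 X^r over [r <= d].
    Sorting tuples by their multiplicities gives
      E_theta[M(T)] = d!^2 [X^d] \prod_x G (theta x).
    For two letters of weights [a] and [b] and for [k <= d], with
    [s = a + b] and [p = a * b],
      k!^2 [X^k] (G a * G b) = \sum_i 'C(k, i)^2 a^i b^(k - i)
                             = [X^k] (X^2 + s X + p)^k,
    which for fixed [s] is nondecreasing in [p], strictly so if [k >= 2] and
    [s > 0].  While theta is not uniform, some letter has weight > 1/n and some
    other one weight < 1/n; giving the first weight 1/n and transferring the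
    excess to the second keeps [s], increases [p], and leaves fewer letters
    whose weight differs from 1/n. *)
Require Import Defs.
From mathcomp Require Import all_boot all_order all_algebra.
From mathcomp Require Import reals ring lra.
Set Implicit Arguments.
Unset Strict Implicit.
Unset Printing Implicit Defensive.
Import Order.TTheory GRing.Theory Num.Theory.
Local Open Scope ring_scope.

(** * The mean as a coefficient of a product of polynomials, one factor per letter *)

Lemma coef_prod_poly (R : comNzRingType) (X : finType) (n d : nat)
    (a : X -> nat -> R) :
  (\prod_(x : X) \poly_(i < n) a x i)`_d =
  \sum_(c : {ffun X -> 'I_n} | (\sum_(x : X) c x)%N == d) \prod_(x : X) a x (c x).
Proof.
under eq_bigr do rewrite poly_def.
rewrite bigA_distr_bigA coef_sum [RHS]big_mkcond /=.
apply: eq_bigr => c _.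
have -> : \prod_(x : X) (a x (c x) *: 'X^(c x)) =
  (\prod_(x : X) a x (c x)) *: 'X^(\sum_(x : X) c x) :> {poly R}.
  under eq_bigr do rewrite -mul_polyC.
  by rewrite big_split /= prodrXr -rmorph_prod /= mul_polyC.
by rewrite coefZ coefXn eq_sym; case: eqP; rewrite ?mulr1 ?mulr0.
Qed.

(** The tuples counted are exactly the rearrangements of one word [s] that contains [c x] copies of
    each letter [x], so [size_permutations_fact] applies. *)
Lemma card_tuple_count (X : finType) (d : nat) (c : X -> nat) :
  (\sum_(x : X) c x = d)%N ->
  (#|[pred t : d.-tuple X | [forall x, count_mem x t == c x]]|
     * \prod_(x : X) (c x)`! = d`!)%N.
Proof.
move=> cd; set s := flatten [seq nseq (c x) x | x <- enum X].
have cs x : count_mem x s = c x.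
  rewrite count_flatten sumnE 2!big_map big_enum /= (bigD1 x) //=.
  rewrite count_nseq /= eqxx mul1n big1 ?addn0 // => y yx.
  by rewrite count_nseq /= (negPf yx).
have ss : size s = d.
  rewrite size_flatten sumnE 2!big_map big_enum /= -cd.
  by apply: eq_bigr => x _; rewrite size_nseq.
rewrite -[in RHS]ss -size_permutations_fact; congr (_ * _)%N; last first.
  by apply: eq_bigr => x _; rewrite cs.
rewrite cardE -(size_map val); apply/perm_size/uniq_perm.
- by rewrite (map_inj_uniq val_inj) enum_uniq.
- exact: permutations_uniq.
move=> u; rewrite mem_permutations.
apply/mapP/idP => [[t + ->]|us]; first rewrite mem_enum => /forallP tc.
  by apply/allP => x _ /=; rewrite cs.
have su : size u == d by rewrite (perm_size us) ss.
exists (Tuple su) => //; rewrite mem_enum; apply/forallP => x /=.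
by rewrite (permP us) cs.
Qed.

Lemma prod_tuple_count (R : comNzRingType) (X : finType) (d : nat)
    (t : d.-tuple X) (f : X -> R) :
  \prod_(i < d) f (tnth t i) = \prod_(x : X) f x ^+ count_mem x t.
Proof.
rewrite -(big_tuple _ _ _ xpredT f) /=.
elim: (tval t) => [|y s IHs]; first by rewrite big_nil big1.
rewrite big_cons IHs (bigD1 y) //= [RHS](bigD1 y) //= eqxx exprS -mulrA.
congr (_ * (_ * _)); apply: eq_bigr => x xy.
by rewrite eq_sym (negPf xy).
Qed.

Definition inv_fact_sqr_poly (R : fieldType) (d : nat) (a : R) : {poly R} :=
  \poly_(i < d.+1) (a ^+ i / (i`!)%:R ^+ 2).

(** The multinomial coefficient of a count vector enters twice: as the number of tuples with these
    counts, and as the value of [rearrangements] on each of them. Hence the squares of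
    factorials. *)
Lemma mean_rearrangements_coef (R : realType) (X : finType) (d : nat)
    (theta : {ffun X -> R}) :
  mean_rearrangements d theta =
  (d`!)%:R ^+ 2 * (\prod_(x : X) inv_fact_sqr_poly d (theta x))`_d.
Proof.
have fact_neq0 n : n`!%:R != 0 :> R by rewrite pnatr_eq0 -lt0n fact_gt0.
rewrite mean_rearrangementsE coef_prod_poly mulr_sumr.
(* [inord] never falls back on its default value, since a count is at most the length [d]. *)
pose counts (t : d.-tuple X) : {ffun X -> 'I_d.+1} :=
  [ffun x => inord (count_mem x t)].
have countsE t x : counts t x = count_mem x t :> nat.
  by rewrite ffunE inordK // ltnS -[leqRHS](size_tuple t) count_size.
rewrite (partition_big counts
  (fun c : {ffun X -> 'I_d.+1} => (\sum_(x : X) c x)%N == d)) /=; last first.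
  move=> t _; under eq_bigr do rewrite countsE.
  apply/eqP; rewrite -[RHS](size_tuple t) -(perm_size (perm_count_undup t)).
  rewrite size_flatten sumnE !big_map.
  under [RHS]eq_bigr do rewrite size_nseq.
  rewrite [RHS]big_uniq ?undup_uniq // [RHS]big_mkcond /=.
  apply: eq_bigr => x _; rewrite mem_undup.
  by case: ifPn => // /count_memPn ->.
apply: eq_bigr => c /eqP cd.
have PE : \prod_x (c x)`!%:R != 0 :> R by apply/prodf_neq0.
(* All tuples with count vector [c] contribute the same term, so their sum is this term times their
   number. *)
rewrite (eq_bigr (fun=> d`!%:R / \prod_x (c x)`!%:R * \prod_x theta x ^+ c x)).
  rewrite (eq_bigl
    [in [pred t : d.-tuple X | [forall x, count_mem x t == c x]]]).
    have := congr1 (fun n => n%:R : R) (card_tuple_count cd).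
    rewrite natrM natr_prod => /(canRL (mulfK PE)) N.
    rewrite sumr_const -[LHS]mulr_natl N big_split /= prodfV prodrXl.
    by field.
  move=> t; rewrite !inE; apply/eqP/forallP => [<- x|tc].
    by rewrite countsE.
  by apply/ffunP => x; apply/val_inj; rewrite /= countsE (eqP (tc x)).
move=> t /eqP tc; rewrite prod_tuple_count.
have cE x : count_mem x t = c x by rewrite -tc countsE.
under eq_bigr do rewrite cE; congr (_ * _).
have := congr1 (fun n => n%:R : R) (size_permutations_fact t).
rewrite size_tuple natrM natr_prod.
under eq_bigr do rewrite cE.
by move=> /(canRL (mulfK PE)).
Qed.

(** * The product of the polynomials of two letters, in terms of the sum and product of their
    weights *)

Lemma coef_XDC_exp (R : comNzRingType) (n : nat) (c : R) (j : nat) :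
  (('X + c%:P) ^+ n)`_j = c ^+ (n - j) *+ 'C(n, j).
Proof.
have coefE i : (c%:P ^+ (n - i) * 'X^i *+ 'C(n, i))`_j =
    (c ^+ (n - i) *+ 'C(n, i)) * (j == i)%:R.
  by rewrite -polyC_exp coefMn coefCM coefXn mulrnAl.
rewrite addrC exprDn coef_sum; under eq_bigr do rewrite coefE.
have [jn|nj] := ltnP j n.+1.
  rewrite (bigD1 (Ordinal jn)) //= eqxx mulr1 big1 ?addr0 // => i ij.
  by rewrite (_ : (j == i) = false) ?mulr0 // eq_sym; apply: negPf ij.
rewrite bin_small // mulr0n big1 // => i _.
by rewrite gtn_eqF ?mulr0 // (leq_trans (ltn_ord i)).
Qed.

(* Both sides are the coefficient of [X^k] in
   (X + a)^k (X + b)^k = (X (X + (a + b)) + a b)^k. *)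
Lemma sum_binomial_sqr (R : comNzRingType) (k : nat) (a b : R) :
  \sum_(i < k.+1) a ^+ i * b ^+ (k - i) *+ 'C(k, i) ^ 2 =
  \sum_(m < k.+1) (a + b) ^+ (k - m - m) * (a * b) ^+ m
     *+ ('C(k, m) * 'C(k - m, m)).
Proof.
have /(congr1 (coefp k)) : ('X + b%:P) ^+ k * ('X + a%:P) ^+ k =
    ('X * ('X + (a + b)%:P) + (a * b)%:P) ^+ k.
  by rewrite -exprMn; congr (_ ^+ _); rewrite polyCM polyCD; ring.
rewrite /coefp coefM (exprDn ('X * _)) coef_sum => E.
rewrite (eq_bigr (fun i : 'I_k.+1 =>
    (('X + b%:P) ^+ k)`_i * (('X + a%:P) ^+ k)`_(k - i))) => [|i _].
  rewrite {}E; apply: eq_bigr => m _; have mk : (m <= k)%N by rewrite -ltnS.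
  rewrite coefMn exprMn -polyC_exp coefMC coefXnM ltnNge leq_subr /= subKn //.
  by rewrite coef_XDC_exp mulrnAl -mulrnA mulnC.
have ik : (i <= k)%N by rewrite -ltnS.
by rewrite !coef_XDC_exp subKn // bin_sub // mulrnAl mulrnAr -mulrnA mulrC.
Qed.

(** For [k <= d] the truncation at degree [d] does not reach the coefficient; multiplying it by the
    square of [k!] turns the inverse factorials into squared binomials. *)
Lemma coef_inv_fact_sqr_polyM (F : numFieldType) (d k : nat) (a b : F) :
  (k <= d)%N ->
  (inv_fact_sqr_poly d a * inv_fact_sqr_poly d b)`_k =
  (\sum_(m < k.+1) (a + b) ^+ (k - m - m) * (a * b) ^+ m
     *+ ('C(k, m) * 'C(k - m, m))) / k`!%:R ^+ 2.
Proof.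
move=> kd; rewrite -sum_binomial_sqr coefM mulr_suml.
apply: eq_bigr => i _; have ik : (i <= k)%N by rewrite -ltnS.
have fact_neq0 n : n`!%:R != 0 :> F by rewrite pnatr_eq0 -lt0n fact_gt0.
rewrite !coef_poly !ltnS (leq_trans ik kd) (leq_trans (leq_subr _ _) kd).
rewrite -(bin_fact ik) -[in RHS]mulr_natr !natrM -?natrX.
have := fact_neq0 k; rewrite -{1}(bin_fact ik) !natrM !mulf_eq0 !negb_or.
move=> /and3P[C0 _ _]; field.
by rewrite C0 !fact_neq0.
Qed.

Lemma coef_inv_fact_sqr_poly_ge0 (F : numFieldType) (d k : nat) (a : F) :
  0 <= a -> 0 <= (inv_fact_sqr_poly d a)`_k.
Proof.
move=> a0; rewrite coef_poly; case: ifP => // _.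
by rewrite divr_ge0 ?exprn_ge0 ?ler0n.
Qed.

Lemma le_coef_inv_fact_sqr_polyM (F : numFieldType) (d k : nat) (a b a' b' : F) :
  (k <= d)%N -> 0 <= a -> 0 <= b -> a' + b' = a + b -> a * b <= a' * b' ->
  (inv_fact_sqr_poly d a * inv_fact_sqr_poly d b)`_k <=
  (inv_fact_sqr_poly d a' * inv_fact_sqr_poly d b')`_k.
Proof.
move=> kd a0 b0 sE ab; rewrite !coef_inv_fact_sqr_polyM // sE.
rewrite ler_wpM2r ?invr_ge0 ?exprn_ge0 ?ler0n //.
have p0 : 0 <= a * b by exact: mulr_ge0.
apply: ler_sum => m _; apply/ler_wMn2r/ler_wpM2l.
  by rewrite exprn_ge0 ?addr_ge0.
by rewrite lerXn2r // ?nnegrE ?(le_trans p0).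
Qed.

Lemma lt_coef_inv_fact_sqr_polyM (F : numFieldType) (d k : nat) (a b a' b' : F) :
  (1 < k <= d)%N -> 0 <= a -> 0 <= b -> 0 < a + b -> a' + b' = a + b ->
  a * b < a' * b' ->
  (inv_fact_sqr_poly d a * inv_fact_sqr_poly d b)`_k <
  (inv_fact_sqr_poly d a' * inv_fact_sqr_poly d b')`_k.
Proof.
move=> /andP[k1 kd] a0 b0 s0 sE ab; rewrite !coef_inv_fact_sqr_polyM // sE.
rewrite ltr_pM2r ?invr_gt0 ?exprn_gt0 ?ltr0n ?fact_gt0 //.
have k1' : (1 < k.+1)%N by rewrite ltnS ltnW.
(* Strictness comes from the term [m = 1]: it is linear in the product of the weights, with factor
   [k * (k - 1)] times a power of [a + b], which is positive. *)
rewrite (bigD1 (Ordinal k1')) //= [ltRHS](bigD1 (Ordinal k1')) //=.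
apply: ltr_leD.
  rewrite !expr1 ltr_pMn2r; first by rewrite ltr_pM2l ?exprn_gt0.
  by rewrite bin1 muln_gt0 bin1 subn_gt0 k1 (ltnW k1).
have p0 : 0 <= a * b by exact: mulr_ge0.
apply: ler_sum => m _; apply/ler_wMn2r/ler_wpM2l.
  by rewrite exprn_ge0 ?addr_ge0.
by rewrite lerXn2r // ?nnegrE ?(le_trans p0) // ltW.
Qed.

(** * Effect on the mean of changing the weights of two letters *)

Lemma bigD2 (T : Type) (idx : T) (op : Monoid.com_law idx) (I : finType)
    (f : I -> T) (x y : I) :
  x != y ->
  \big[op/idx]_z f z =
  op (f x) (op (f y) (\big[op/idx]_(z | (z != x) && (z != y)) f z)).
Proof. by move=> xy; rewrite (bigD1 x) // (bigD1 y) // eq_sym. Qed.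

Lemma coef_prod_ge0 (F : numFieldType) (I : Type) (r : seq I) (P : pred I)
    (p : I -> {poly F}) :
  (forall i k, P i -> 0 <= (p i)`_k) -> forall k, 0 <= (\prod_(i <- r | P i) p i)`_k.
Proof.
move=> p0; elim/big_ind: _ => [k|q q' q0 q0' k|i Pi k]; last exact: p0.
  by rewrite coef1 ler0n.
by rewrite coefM sumr_ge0 // => j _; rewrite mulr_ge0.
Qed.

Lemma mean_rearrangements_lt (R : realType) (X : finType) (d : nat)
    (theta theta' : {ffun X -> R}) (x y : X) :
  (2 <= d)%N -> (forall z, 0 <= theta z) -> x != y ->
  (forall z, z != x -> z != y -> theta' z = theta z) ->
  theta' x + theta' y = theta x + theta y ->
  theta x * theta y < theta' x * theta' y ->
  0 < theta x + theta y ->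
  mean_rearrangements d theta < mean_rearrangements d theta'.
Proof.
move=> d2 th0 xy thE sE pE s0; rewrite !mean_rearrangements_coef.
rewrite ltr_pM2l ?exprn_gt0 ?ltr0n ?fact_gt0 //.
rewrite !(bigD2 _ _ xy) /= !mulrA.
rewrite [in ltRHS](eq_bigr (fun z => inv_fact_sqr_poly d (theta z))); last first.
  by move=> z /andP[zx zy]; rewrite thE.
set H := \prod_(_ | _) _.
have H0 k : 0 <= H`_k.
  by apply: coef_prod_ge0 => z j _; exact: coef_inv_fact_sqr_poly_ge0.
have H00 : H`_0 = 1.
  rewrite -horner_coef0 horner_prod big1 // => z _.
  by rewrite horner_coef0 coef_poly expr0 fact0 expr1n divr1.
(* In the convolution with the common factor [H], the terms of index below [d] increase weakly; the
   last one carries the constant coefficient 1 of [H] and increases strictly because [d >= 2]. *)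
rewrite !coefM !big_ord_recr /= subnn H00 !mulr1; apply: ler_ltD.
  apply: ler_sum => k _; apply: ler_wpM2r => //.
  by apply: le_coef_inv_fact_sqr_polyM => //; [exact: ltnW | exact: ltW].
by apply: lt_coef_inv_fact_sqr_polyM; rewrite ?d2 ?leqnn.
Qed.

(** * Transfers of weight that lead to the uniform distribution *)

Lemma distribution_exists_lt (R : realType) (X : finType) (p q : {ffun X -> R}) :
  is_distribution p -> is_distribution q -> p != q -> exists x, q x < p x.
Proof.
move=> [_ p1] [_ q1] pq; apply/existsP; apply: contraNT pq.
rewrite negb_exists => /forallP le_pq.
(* Otherwise the differences [q x - p x] are nonnegative with sum 0, so all of them vanish. *)
have S0 : \sum_x (q x - p x) = 0 by rewrite sumrB p1 q1 subrr.
apply/eqP/ffunP => x; apply/esym/eqP; rewrite -subr_eq0; apply/eqP.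
by apply: (psumr_eq0P _ S0) => // z _; rewrite subr_ge0 leNgt.
Qed.

Lemma mean_rearrangements_lt_uniform (R : realType) (X : finType) (d : nat)
    (theta : {ffun X -> R}) :
  (2 <= d)%N -> is_distribution theta -> theta != uniform R X ->
  mean_rearrangements d theta < mean_rearrangements d (uniform R X).
Proof.
move=> d2; have [n] := ubnP #|[pred x | theta x != uniform R X x]|.
elim: n theta => // n IHn theta; rewrite ltnS => thn theta_distr thU.
have [th0 th1] := theta_distr.
have X0 : (0 < #|X|)%N.
  rewrite lt0n; apply: contra_neq thU => /card0_eq X0.
  by apply/ffunP => x; have := X0 x; rewrite inE.
have U_distr := is_distribution_uniform R X0.
set u : R := #|X|%:R^-1; have u0 : 0 < u by rewrite invr_gt0 ltr0n.
have UE x : uniform R X x = u by rewrite ffunE.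
have [x] := distribution_exists_lt theta_distr U_distr thU.
rewrite UE => xu.
have [y] := distribution_exists_lt U_distr theta_distr (contra_neq esym thU).
rewrite UE => yu.
have xy : x != y by apply: contraTneq xu => ->; rewrite -leNgt ltW.
pose theta' := [ffun z => if z == x then u
  else if z == y then theta x + theta y - u else theta z].
have tx : theta' x = u by rewrite ffunE eqxx.
have ty : theta' y = theta x + theta y - u by rewrite ffunE eq_sym (negPf xy) eqxx.
have tz z : z != x -> z != y -> theta' z = theta z.
  by move=> /negPf zx /negPf zy; rewrite ffunE zx zy.
have lt_th : mean_rearrangements d theta < mean_rearrangements d theta'.
  apply: (@mean_rearrangements_lt _ _ _ _ _ x y) => //.
  - by rewrite tx ty; ring.
  (* The product grows by [(theta x - u) * (u - theta y)], which is positive. *)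
  - by rewrite tx ty; nra.
  - by rewrite ltr_pwDl // (lt_trans u0).
have [<-//|t'U] := eqVneq theta' (uniform R X).
apply: lt_trans lt_th (IHn _ _ _ t'U).
  (* The letter [x] leaves the set of letters with weight other than [u], and none enters it: [y]
     belonged to it already. *)
  apply: leq_trans thn; apply: proper_card; apply/properP; split.
    apply/subsetP => z; rewrite !inE UE ffunE; case: (eqVneq z x) => [_|_].
      by rewrite eqxx.
    by case: (eqVneq z y) => // -> _; rewrite lt_eqF.
  by exists x; rewrite !inE UE ?tx ?eqxx // gt_eqF.
split=> [z|]; first rewrite ffunE.
  by case: eqP => _; [exact: ltW | case: eqP => // _; have := th0 y; lra].
rewrite -th1 [LHS](bigD2 _ _ xy) [RHS](bigD2 _ _ xy) /= !addrA tx ty.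
rewrite (eq_bigr theta) => [|z /andP[zx zy]]; last exact: tz.
by congr (_ + _); ring.
Qed.

Theorem theorem3 (R : realType) (d : nat) (X : finType)
    (d_ge2 : (2 <= d)%N) (X_nonempty : (0 < #|X|)%N)
    (theta : {ffun X -> R}) (theta_distr : is_distribution theta) :
  mean_rearrangements d theta <= mean_rearrangements d (uniform R X) /\
  (mean_rearrangements d theta = mean_rearrangements d (uniform R X) <->
   theta = uniform R X).
Proof.
have [->|thU] := eqVneq theta (uniform R X); first by split.
have lt_th := mean_rearrangements_lt_uniform d_ge2 theta_distr thU.
split; first exact: ltW.
by split=> E; [rewrite E ltxx in lt_th | case/eqP: thU].
Qed.
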